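(* Let $n$ be a positive integer and let $r$ be an integer with $1\le r\le n$. In $\mathbb{Q}[x_1,\ldots,x_n]$ define $$\mathsf{q}_r(x):=\sum_{k=1}^{n+1-r}x_k\prod_{\ell=n+2-r}^n(x_k-x_\ell),\qquad \mathsf{p}_r(x):=\sum_{k=1}^n x_k^r.$$ Then $$\mathsf{q}_r(x)=\sum_{i=0}^{r-1}(-1)^i\,e_i(x_{n+2-r},\ldots,x_n)\,\mathsf{p}_{r-i}(x).$$
   Context: $e_i(y_1,\ldots,y_m)$ denotes the degree-$i$ elementary symmetric polynomial in the listed variables, with $e_0=1$ (also when the list of variables is empty, as happens for $r=1$); an empty product equals $1$. The polynomials $\mathsf{q}_r(x)$, $1\le r\le n$, are the generators $\check f_{n,n+1-r}$ of the ideal $\check I(n,n,\ldots,n)=(\check f_{n,j}\mid 1\le j\le n)$, where $\check f_{i,j}=\sum_{k=1}^j x_k\prod_{\ell=j+1}^i(x_k-x_\ell)$; the quotient of $\mathbb{Q}[x_1,\ldots,x_n]$ by this ideal presents the rational cohomology ring of the full flag variety of $\mathbb{C}^n$. *)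

(* Defs.v *)
From HB Require Import structures.
From mathcomp Require Import all_boot all_order all_algebra.
From mathcomp Require Import mpoly.

Set Implicit Arguments.
Unset Strict Implicit.
Unset Printing Implicit Defensive.

Import GRing.Theory.
Local Open Scope ring_scope.

(* Throughout, the ordinal k : 'I_n stands for the index k.+1 of 1, ..., n,   *)
(* so that the variable written x_(k.+1) on paper is 'X_k.                    *)

(* e_i(y_1, ..., y_m), where s = [:: y_1; ...; y_m] is any list of            *)
(* polynomials, possibly empty.                                               *)
Definition elem_sym (n i : nat) (s : seq {mpoly rat[n]}) : {mpoly rat[n]} :=
  mesym (size s) rat i \mPo in_tuple s.

(* The list x_(m), x_(m+1), ..., x_(n), with indices starting at 1.           *)
Definition vars_from (n m : nat) : seq {mpoly rat[n]} :=
  [seq 'X_l | l : 'I_n <- enum 'I_n & (m <= l.+1)%N].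

Definition q_poly (n r : nat) : {mpoly rat[n]} :=
  \sum_(k < n | (k.+1 <= n.+1 - r)%N)
    'X_k * \prod_(l < n | (n.+2 - r <= l.+1)%N) ('X_k - 'X_l).

Definition p_poly (n r : nat) : {mpoly rat[n]} := \sum_(k < n) 'X_k ^+ r.

(* Main.v *)
(** Evaluate Vieta's formula for [\prod_(l >= n+2-r) (T - x_l)] at [T = x_k],
    multiply by [x_k] and sum over all [k]: the terms with [k >= n+2-r] vanish. *)

Require Import Defs.
From mathcomp Require Import all_boot all_order all_algebra.
From mathcomp Require Import zify mpoly.

Import GRing.Theory.
Local Open Scope ring_scope.

(** Extending the sum in [q_poly] to every [k] is harmless: a tail index makes the factor
    ['X_k - 'X_k] appear. Vieta ([prod_subr_elem_sym]) then expands each product in powers of ['X_k]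
    with coefficients independent of [k], so exchanging the sums collects power sums. *)

Lemma elem_symE (n i : nat) (s : seq {mpoly rat[n]}) :
  elem_sym i s =
    \sum_(h : {set 'I_(size s)} | #|h| == i) \prod_(j in h) s`_j.
Proof.
rewrite /elem_sym /mesym raddf_sum /=; apply: eq_bigr => h _.
by rewrite rmorph_prod /=; apply: eq_bigr => j _; rewrite comp_mpolyXU.
Qed.

(** Vieta's formula for a univariate polynomial over [{mpoly rat[n]}] with roots [s], evaluated at
    [y]. *)
Lemma prod_subr_elem_sym (n : nat) (s : seq {mpoly rat[n]}) (y : {mpoly rat[n]}) :
  \prod_(z <- s) (y - z) =
    \sum_(i < (size s).+1) (-1) ^+ i * elem_sym i s * y ^+ (size s - i).
Proof.
pose P := \prod_(z <- s) ('X - z%:P).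
have -> : \prod_(z <- s) (y - z) = P.[y].
  by rewrite horner_prod; apply: eq_bigr => z _; rewrite hornerXsubC.
(* Reversal indexes terms by codegree, which is the degree of the elementary symmetric
   polynomial. *)
rewrite horner_coef size_prod_XsubC (reindex_inj rev_ord_inj) /=.
apply: eq_bigr => i _; have le_is : (i <= size s)%N by rewrite -ltnS.
by rewrite subSS elem_symE coef_prod_XsubC ?leq_subr // subKn //.
Qed.

Lemma size_vars_from (n m : nat) : size (vars_from n m.+1) = (n - m)%N.
Proof.
rewrite size_map size_filter -(count_map val (leq m)) val_enum_ord.
elim: n => // n IHn; rewrite -addn1 iotaD count_cat IHn /=.
by lia.
Qed.

Lemma prod_vars_from (n m : nat) (F : {mpoly rat[n]} -> {mpoly rat[n]}) :
  \prod_(z <- vars_from n m) F z = \prod_(l < n | (m <= l.+1)%N) F 'X_l.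
Proof. by rewrite big_map big_filter big_enum_cond. Qed.

Theorem mainTheorem3 (n r : nat) (hn : (0 < n)%N) (hr : (1 <= r <= n)%N) :
  q_poly n r =
    \sum_(i < r) (-1) ^+ i * elem_sym i (vars_from n (n.+2 - r)) * p_poly n (r - i).
Proof.
case/andP: hr => r_gt0 le_rn; set s := vars_from n (n.+2 - r).
have size_s : size s = r.-1.
  by rewrite /s (_ : n.+2 - r = (n.+1 - r).+1)%N ?size_vars_from; lia.
have -> : q_poly n r = \sum_(k < n) 'X_k * \prod_(z <- s) ('X_k - z).
  rewrite /q_poly big_mkcond; apply: eq_bigr => k _.
  rewrite prod_vars_from; case: ifPn => // k_tail.
  (* Here [k] is a tail index, so the factor at [l = k] is zero. *)
  by rewrite (bigD1 k) /= ?subrr ?mul0r ?mulr0 //; lia.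
under eq_bigr do rewrite prod_subr_elem_sym size_s prednK // big_distrr /=.
rewrite exchange_big /=; apply: eq_bigr => i _; rewrite [RHS]mulr_sumr.
apply: eq_bigr => k _; rewrite mulrCA -exprS.
(* The prefactor ['X_k] raises the exponent [r.-1 - i] to [r - i]; truncated subtraction is safe as
   [i < r]. *)
by congr (_ * _ ^+ _); have := ltn_ord i; lia.
Qed.
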